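(* Let $\psi'$ be a continuously differentiable, strongly convex function (defined on a neighborhood of each $\mathcal X_i$), and let $G(\pi_i,\pi_i')=D_{\psi'}(\pi_i,\pi_i')$. Fix $\mu>0$ and $\sigma^0\in\mathcal X$, and define $\sigma^{k+1}=\pi^{\mu,\sigma^k}$ for $k\ge0$. Then there exists a Nash equilibrium $\pi^*\in\Pi^*$ such that $\sigma^K\to\pi^*$ as $K\to\infty$.
   Context: Game. Let $N\ge1$. For each $i\in[N]$, $\mathcal X_i\subseteq\mathbb R^{d_i}$ is a nonempty compact convex set, and $\mathcal X=\prod_i\mathcal X_i$. Each $v_i:\mathcal X\to\mathbb R$ is differentiable, with block gradient $\nabla_{\pi_i}v_i$. The game is monotone: $\sum_i\langle\nabla_{\pi_i}v_i(\pi)-\nabla_{\pi_i}v_i(\pi'),\pi_i-\pi_i'\rangle\le0$ for all $\pi,\pi'$. A Nash equilibrium is a $\pi^*\in\mathcal X$ with $v_i(\pi^* )\ge v_i(\pi_i,\pi^*_{-i})$ for all $i$ and $\pi_i\in\mathcal X_i$. $\Pi^*$ is the set of Nash equilibria. Bregman divergence: $D_{\psi'}(x,y)=\psi'(x)-\psi'(y)-\langle\nabla\psi'(y),x-y\rangle$, and for profiles $D_{\psi'}(\pi,\pi')=\sum_iD_{\psi'}(\pi_i,\pi_i')$. Perturbed equilibrium. For $\mu>0$ and $\sigma\in\mathcal X$, $\pi^{\mu,\sigma}$ is the (unique) profile with $\pi_i^{\mu,\sigma}\in\arg\max_{\pi_i\in\mathcal X_i}\{v_i(\pi_i,\pi^{\mu,\sigma}_{-i})-\mu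 G(\pi_i,\sigma_i)\}$ for all $i$. *)

(* Defs.v *)
From HB Require Import structures.
From mathcomp Require Import all_boot all_order all_algebra.
From mathcomp Require Import all_classical all_reals all_analysis.
Set Implicit Arguments. Unset Strict Implicit. Unset Printing Implicit Defensive.
Import Order.TTheory GRing.Theory Num.Theory.
Import numFieldNormedType.Exports.
Local Open Scope classical_set_scope.
Local Open Scope ring_scope.

Definition dotv (R : realType) (n : nat) (a b : 'rV[R]_n) : R :=
  \sum_(j < n) a 0 j * b 0 j.
Definition sqnormv (R : realType) (n : nat) (a : 'rV[R]_n) : R := dotv a a.

Definition gradr (R : realType) (n : nat) (f : 'rV[R]_n -> R) (x : 'rV[R]_n)
  : 'rV[R]_n := \row_(j < n) ('D_(delta_mx 0 j) f x).

(* Profiles of an N-player game with strategy spaces R^(d i) are flattened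
   into R^(\sum_i d i); block i of a profile x is  submxrow x i : 'rV_(d i). *)
Definition Dim (N : nat) (d : 'I_N -> nat) : nat := \sum_(i < N) d i.

Definition bgrad (R : realType) (N : nat) (d : 'I_N -> nat)
  (f : 'rV[R]_(Dim d) -> R) (i : 'I_N) (x : 'rV[R]_(Dim d)) : 'rV[R]_(d i) :=
  \row_(j < d i) ('D_(delta_mx 0 (tagnat.Rank i j)) f x).

Definition profile_set (R : realType) (N : nat) (d : 'I_N -> nat)
  (X : forall i : 'I_N, set 'rV[R]_(d i)) : set 'rV[R]_(Dim d) :=
  [set x | forall i, X i (submxrow x i)].

Definition deviation (R : realType) (N : nat) (d : 'I_N -> nat)
  (i : 'I_N) (x y : 'rV[R]_(Dim d)) : Prop :=
  forall j : 'I_N, j != i -> submxrow y j = submxrow x j.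

Definition convex_setv (R : realType) (n : nat) (A : set 'rV[R]_n) : Prop :=
  forall a b, A a -> A b -> forall t : R, 0 <= t <= 1 ->
    A (t *: a + (1 - t) *: b).

Definition monotone_game (R : realType) (N : nat) (d : 'I_N -> nat)
  (X : forall i : 'I_N, set 'rV[R]_(d i))
  (v : 'I_N -> 'rV[R]_(Dim d) -> R) : Prop :=
  forall x y, profile_set X x -> profile_set X y ->
    \sum_(i < N) dotv (bgrad (v i) i x - bgrad (v i) i y)
                      (submxrow x i - submxrow y i) <= 0.

Definition nash_eq (R : realType) (N : nat) (d : 'I_N -> nat)
  (X : forall i : 'I_N, set 'rV[R]_(d i))
  (v : 'I_N -> 'rV[R]_(Dim d) -> R) (x : 'rV[R]_(Dim d)) : Prop :=
  profile_set X x /\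
  forall (i : 'I_N) (y : 'rV[R]_(Dim d)),
    deviation i x y -> X i (submxrow y i) -> v i y <= v i x.

Definition bregman (R : realType) (n : nat) (psi : 'rV[R]_n -> R)
  (x y : 'rV[R]_n) : R :=
  psi x - psi y - dotv (gradr psi y) (x - y).

Definition C1_strongly_convex_near (R : realType) (n : nat)
  (psi : 'rV[R]_n -> R) (A : set 'rV[R]_n) : Prop :=
  exists U : set 'rV[R]_n, open U /\ convex_setv U /\ A `<=` U /\
    (forall x, U x -> differentiable psi x) /\
    (forall x, U x -> {for x, continuous (gradr psi)}) /\
    exists m : R, 0 < m /\ forall x y, U x -> U y ->
      psi y >= psi x + dotv (gradr psi x) (y - x) + m / 2 * sqnormv (y - x).

Definition perturbed_eq (R : realType) (N : nat) (d : 'I_N -> nat)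
  (X : forall i : 'I_N, set 'rV[R]_(d i))
  (v : 'I_N -> 'rV[R]_(Dim d) -> R)
  (psi : forall i : 'I_N, 'rV[R]_(d i) -> R)
  (mu : R) (sigma x : 'rV[R]_(Dim d)) : Prop :=
  profile_set X x /\
  forall (i : 'I_N) (y : 'rV[R]_(Dim d)),
    deviation i x y -> X i (submxrow y i) ->
    v i y - mu * bregman (psi i) (submxrow y i) (submxrow sigma i)
      <= v i x - mu * bregman (psi i) (submxrow x i) (submxrow sigma i).

(* Main.v *)
(* Every statement about Nash equilibria goes through the Minty variational
   inequality <grad v(z), z - x> <= 0 for all z, which is stable under limits in
   x even though the payoff gradients need not be continuous.  The first-order
   condition for sigma (k+1), the three-point identity and monotonicity give
     <grad v(y), y - sigma (k+1)>
       <= mu (D(y, sigma k) - D(y, sigma (k+1)) - D(sigma (k+1), sigma k)).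
   Summing over k, a limit of the averages of the sigma (k+1) solves the Minty
   inequality, so a solution p exists.  Then D(p, sigma k) is nonincreasing,
   whence D(sigma (k+1), sigma k) and sigma (k+1) - sigma k tend to 0, and by
   continuity of grad psi every limit point x of sigma is again a solution.
   Finally D(x, sigma k) is nonincreasing and tends to 0 along the limit point,
   hence tends to 0.  Limit points are taken along one ultrafilter on nat, which
   replaces the extraction of subsequences. *)

Require Import Defs.
From HB Require Import structures.
From mathcomp Require Import all_boot all_order all_algebra.
From mathcomp Require Import all_classical all_reals all_analysis.
From mathcomp Require Import ring lra.
Import Order.TTheory GRing.Theory Num.Theory.
Import numFieldNormedType.Exports.
Local Open Scope classical_set_scope.
Local Open Scope ring_scope.
Set Implicit Arguments.
Unset Strict Implicit.

(** * Bilinearity of the dot product *)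

Section DotProduct.
Variables (R : realType) (n : nat).
Implicit Types a b c : 'rV[R]_n.

Lemma dotvDr a b c : dotv a (b + c) = dotv a b + dotv a c.
Proof. by rewrite -big_split; apply: eq_bigr => j _; rewrite !mxE mulrDr. Qed.

Lemma dotvNr a b : dotv a (- b) = - dotv a b.
Proof. by rewrite -sumrN; apply: eq_bigr => j _; rewrite !mxE mulrN. Qed.

Lemma dotvDl a b c : dotv (a + b) c = dotv a c + dotv b c.
Proof. by rewrite -big_split; apply: eq_bigr => j _; rewrite !mxE mulrDl. Qed.

Lemma dotvNl a b : dotv (- a) b = - dotv a b.
Proof. by rewrite -sumrN; apply: eq_bigr => j _; rewrite !mxE mulNr. Qed.

Lemma dotvZr (t : R) a b : dotv a (t *: b) = t * dotv a b.
Proof. by rewrite mulr_sumr; apply: eq_bigr => j _; rewrite !mxE mulrCA. Qed.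

Lemma dotv0r a : dotv a 0 = 0.
Proof. by rewrite -(subrr 0) dotvDr dotvNr subrr. Qed.

Lemma sqr_coord_le_sqnormv a j : a 0 j ^+ 2 <= sqnormv a.
Proof.
rewrite /sqnormv /dotv (bigD1 j) //= expr2 lerDl.
by apply: sumr_ge0 => k _; exact: sqr_ge0.
Qed.

Lemma sqnormv_ge0 a : 0 <= sqnormv a.
Proof. by apply: sumr_ge0 => k _; exact: sqr_ge0. Qed.

End DotProduct.

(** * Limits of row vectors along a filter *)

Section RowConvergence.
Variables (R : realType) (T : Type) (F : set_system T).
Context {FF : Filter F}.

Lemma cvg_sum I (r : seq I) (P : pred I) (f : I -> T -> R) (l : I -> R) :
  (forall i, P i -> f i x @[x --> F] --> l i) ->
  \sum_(i <- r | P i) f i x @[x --> F] --> \sum_(i <- r | P i) l i.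
Proof. by move=> fl; apply: cvg_big => //; exact: add_continuous. Qed.

Lemma cvg_sum0 I (r : seq I) (P : pred I) (f : I -> T -> R) :
  (forall i, P i -> f i x @[x --> F] --> (0 : R)) ->
  \sum_(i <- r | P i) f i x @[x --> F] --> (0 : R).
Proof. by move=> /cvg_sum -/(_ r); rewrite [X in _ --> X]big1. Qed.

Lemma cvg_row n (f : T -> 'rV[R]_n) (l : 'rV[R]_n) :
  (forall j, f x 0 j @[x --> F] --> l 0 j) -> f x @[x --> F] --> l.
Proof.
move=> fl; apply/cvg_mx_entourageP => A entA.
have lA (i : 'I_1) (j : 'I_n) : \forall x \near F, (l i j, f x i j) \in A.
  have Aj : \forall x \near F, A (l 0 j, f x 0 j).
    exact: (cvg_entourageP _ _).1 (fl j) A entA.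
  by apply: (@filterS _ F) Aj => x; rewrite inE ord1.
have lA' i := filter_forall FF (lA i).
exact: (filter_forall FF lA').
Qed.

Lemma cvg_coord n (f : T -> 'rV[R]_n) (l : 'rV[R]_n) j :
  f x @[x --> F] --> l -> f x 0 j @[x --> F] --> l 0 j.
Proof.
move=> fl.
exact: (@cvg_comp _ _ _ f (fun M : 'rV[R]_n => M 0 j) _ _ _ fl
  (@coord_continuous _ _ _ _ _ l)).
Qed.

Lemma cvg_dotv n (f g : T -> 'rV[R]_n) (a b : 'rV[R]_n) :
  f x @[x --> F] --> a -> g x @[x --> F] --> b ->
  dotv (f x) (g x) @[x --> F] --> dotv a b.
Proof.
by move=> fa gb; apply: cvg_sum => j _; apply: cvgM; exact: cvg_coord.
Qed.

Lemma cvg_submxrow N (d : 'I_N -> nat) (f : T -> 'rV[R]_(Dim d))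
    (l : 'rV[R]_(Dim d)) i :
  f x @[x --> F] --> l ->
  (submxrow (f x) i : 'rV_(d i)) @[x --> F] --> (submxrow l i : 'rV_(d i)).
Proof.
move=> fl; apply: cvg_row => j; rewrite !mxE.
have -> : (fun x => submxrow (f x) i 0 j) = (fun x => f x 0 (tagnat.Rank i j)).
  by apply/funext => x; rewrite !mxE.
exact: cvg_coord.
Qed.

Lemma cvg_sqnormv0 n (f : T -> 'rV[R]_n) (l : 'rV[R]_n) :
  sqnormv (f x - l) @[x --> F] --> (0 : R) -> f x @[x --> F] --> l.
Proof.
move=> f0; apply: cvg_row => j.
apply/cvgrPdist_lt => e e0.
near=> x.
have fe : `|0 - sqnormv (f x - l)| < e ^+ 2.
  by near: x; exact: (cvgrPdist_lt _ _).1 f0 (e ^+ 2) (exprn_gt0 _ e0).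
rewrite sub0r normrN (ger0_norm (sqnormv_ge0 _)) in fe.
have := le_lt_trans (sqr_coord_le_sqnormv (f x - l) j) fe.
by rewrite !mxE distrC -real_normK ?num_real // ltr_pXn2r ?nnegrE // ltW.
Unshelve. all: by end_near. Qed.

End RowConvergence.

(** Compactness gives a cluster point, which is a limit: for a neighbourhood [B] of it, [U] contains
    the preimage of [B] or of its complement, and the latter contradicts clustering. *)
Lemma compact_ultra_cvg (T : Type) (V : topologicalType) (U : set_system T)
    (A : set V) (f : T -> V) :
  UltraFilter U -> compact A -> (forall t, A (f t)) ->
  exists2 p, A p & f t @[t --> U] --> p.
Proof.
move=> UU kA Af.
have [|p [Ap clp]] := kA (f t @[t --> U]) _.
  by apply: (@filterS _ U _ setT) => [t _|]; [exact: Af | exact: filterT].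
exists p => // B Bp; have [//|UB] := in_ultra_setVsetC (f @^-1` B) UU.
by have [q [nBq Bq]] := clp (~` B) B UB Bp.
Qed.

Lemma derive_gradr (R : realType) n (f : 'rV[R]_n -> R) x w :
  differentiable f x -> 'D_w f x = dotv (gradr f x) w.
Proof.
move=> df; rewrite deriveE // {1}(row_sum_delta w) linear_sum /=.
by apply: eq_bigr => j _; rewrite linearZ /= mxE deriveE // mulrC.
Qed.

(** * Splitting sums and directional derivatives into player blocks *)

Section Blocks.
Variables (R : realType) (N : nat) (d : 'I_N -> nat).

Lemma sum_blocks (f : 'I_(Dim d) -> R) :
  \sum_k f k = \sum_(i < N) \sum_(j < d i) f (tagnat.Rank i j).
Proof.
rewrite sig_big_dep /= (reindex _ tagnat.sig_bij_on) /=.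
by apply: eq_bigr => k _; rewrite tagnat.sig2K.
Qed.

Lemma submxrowD (a b : 'rV[R]_(Dim d)) i :
  submxrow (a + b) i = submxrow a i + submxrow b i :> 'rV_(d i).
Proof. by apply/rowP => j; rewrite !mxE. Qed.

Lemma submxrowN (a : 'rV[R]_(Dim d)) i :
  submxrow (- a) i = - submxrow a i :> 'rV_(d i).
Proof. by apply/rowP => j; rewrite !mxE. Qed.

Lemma submxrowZ (t : R) (a : 'rV[R]_(Dim d)) i :
  submxrow (t *: a) i = t *: submxrow a i :> 'rV_(d i).
Proof. by apply/rowP => j; rewrite !mxE. Qed.

Lemma derive_bgrad (f : 'rV[R]_(Dim d) -> R) x w :
  differentiable f x ->
  'D_w f x = \sum_(i < N) dotv (bgrad f i x) (submxrow w i).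
Proof.
move=> df; rewrite derive_gradr // /dotv sum_blocks.
by apply: eq_bigr => i _; apply: eq_bigr => j _; rewrite !mxE.
Qed.

Lemma derive_bgrad_block (f : 'rV[R]_(Dim d) -> R) x w i :
  differentiable f x -> (forall j, j != i -> submxrow w j = 0 :> 'rV_(d j)) ->
  'D_w f x = dotv (bgrad f i x) (submxrow w i).
Proof.
move=> df w0; rewrite derive_bgrad // (bigD1 i) //= big1 ?addr0 // => j ji.
by rewrite w0 // dotv0r.
Qed.

End Blocks.

(** * Bregman divergences *)

Section Bregman.
Variables (R : realType) (n : nat) (psi : 'rV[R]_n -> R).
Implicit Types (x y z : 'rV[R]_n) (A : set 'rV[R]_n).

Lemma bregman_three_point y a b :
  dotv (gradr psi b - gradr psi a) (y - b)
    = bregman psi y a - bregman psi y b - bregman psi b a.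
Proof. by rewrite /bregman !(dotvDl, dotvDr, dotvNl, dotvNr); ring. Qed.

Lemma bregman_ge_sqnormv A : C1_strongly_convex_near psi A ->
  exists2 m : R, 0 < m &
    forall x y, A x -> A y -> m * sqnormv (x - y) <= bregman psi x y.
Proof.
move=> [U [_ [_ [AU [_ [_ [m [m0 psim]]]]]]]]; exists (m / 2); first by lra.
move=> x y /AU Ux /AU Uy; have := psim y x Uy Ux.
by rewrite /bregman /=; lra.
Qed.

Lemma bregman_ge0 A x y : C1_strongly_convex_near psi A ->
  A x -> A y -> 0 <= bregman psi x y.
Proof.
move=> /bregman_ge_sqnormv[m m0 psim] Ax Ay.
by apply: le_trans (psim x y Ax Ay); rewrite mulr_ge0 ?sqnormv_ge0 // ltW.
Qed.

Lemma cvg_gradr A x T (F : set_system T) {FF : Filter F} (f : T -> 'rV[R]_n) :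
  C1_strongly_convex_near psi A -> A x -> f t @[t --> F] --> x ->
  gradr psi (f t) @[t --> F] --> gradr psi x.
Proof.
move=> [U [_ [_ [AU [_ [cU _]]]]]] /AU/cU cx fx.
exact: (@cvg_comp _ _ _ f (gradr psi) _ _ _ fx cx).
Qed.

(** The base point of the divergence varies, so continuity of [gradr psi] is used along with that of
    [psi]. *)
Lemma cvg_bregman0 A x T (F : set_system T) {FF : Filter F}
    (f : T -> 'rV[R]_n) :
  C1_strongly_convex_near psi A -> A x -> f t @[t --> F] --> x ->
  bregman psi x (f t) @[t --> F] --> (0 : R).
Proof.
move=> psiA Ax fx.
have -> : 0 = psi x - psi x - dotv (gradr psi x) (x - x).
  by rewrite !subrr dotv0r subrr.
have psif : psi (f t) @[t --> F] --> psi x.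
  have [U [_ [_ [AU [dU _]]]]] := psiA.
  have cx := differentiable_continuous (dU _ (AU _ Ax)).
  exact: (@cvg_comp _ _ _ f psi _ _ _ fx cx).
apply: cvgB; first by apply: cvgB => //; exact: cvg_cst.
apply: cvg_dotv; first exact: (cvg_gradr psiA Ax fx).
by apply: cvgB => //; exact: cvg_cst.
Qed.

End Bregman.

(** Divide by [t] and let [t] decrease to 0. The two spaces differ because a payoff depends on the
    whole profile and its regularizer on one block; [c] is meant for the linear term of the
    divergence. *)
Lemma derive_le_derive (R : realType) (V W : normedModType R)
    (f : V -> R) (g : W -> R) x e x' e' (mu c : R) :
  derivable f x e -> derivable g x' e' ->
  (forall t : R, 0 < t <= 1 ->
     f (t *: e + x) - f x <= mu * (g (t *: e' + x') - g x' - t * c)) ->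
  'D_e f x <= mu * ('D_e' g x' - c).
Proof.
move=> /cvg_dnbhs_at_right df /cvg_dnbhs_at_right dg fg.
apply: (ler_cvg_to df).
  apply: cvgM; first exact: cvg_cst.
  by apply: cvgB; [exact: dg | exact: cvg_cst].
near=> t => /=.
have t0 : 0 < t by near: t; exact: nbhs_right_gt.
have t1 : t <= 1 by near: t; exact: nbhs_right_le.
have /fg le_t : 0 < t <= 1 by rewrite t0.
change (t^-1 * (f (t *: e + x) - f x) <=
  mu * (t^-1 * (g (t *: e' + x') - g x') - c)).
rewrite ler_pdivrMl //.
apply: le_trans le_t _; rewrite le_eqVlt; apply/orP; left; apply/eqP.
by field; rewrite gt_eqF.
Unshelve. all: by end_near. Qed.

(** * Directions of one-player deviations *)

Section Profiles.
Variables (R : realType) (N : nat) (d : 'I_N -> nat).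
Implicit Types (w x y : 'rV[R]_(Dim d)).

Definition block_only (i : 'I_N) w : 'rV[R]_(Dim d) :=
  \row_k (if tagnat.sig1 k == i then w 0 k else 0).

Lemma submxrow_block_only i w :
  submxrow (block_only i w) i = submxrow w i :> 'rV_(d i).
Proof. by apply/rowP => j; rewrite !mxE tagnat.Rank1K eqxx. Qed.

Lemma submxrow_block_only_neq i w j : j != i ->
  submxrow (block_only i w) j = 0 :> 'rV_(d j).
Proof.
by move=> ji; apply/rowP => k; rewrite !mxE tagnat.Rank1K (negPf ji).
Qed.

Lemma deviation_line (X : forall i : 'I_N, set 'rV[R]_(d i)) i x w (t : R) :
  (forall j, convex_setv (X j)) -> profile_set X x ->
  (forall j, j != i -> submxrow w j = 0 :> 'rV_(d j)) ->
  X i (submxrow (w + x) i) -> 0 <= t <= 1 ->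
  deviation i x (t *: w + x) /\ profile_set X (t *: w + x).
Proof.
move=> cX Xx w0 Xw t01.
have dev : deviation i x (t *: w + x).
  by move=> j ji; rewrite submxrowD submxrowZ w0 // scaler0 add0r.
split=> // j; have [->|/dev ->//] := eqVneq j i.
have -> : submxrow (t *: w + x) i =
    t *: submxrow (w + x) i + (1 - t) *: submxrow x i :> 'rV_(d i).
  by rewrite !submxrowD submxrowZ scalerDr scalerBl scale1r addrACA subrr addr0.
exact: cX.
Qed.

End Profiles.

(** * The Minty inequality and Nash equilibria *)

Section Game.
Variables (R : realType) (N : nat) (d : 'I_N -> nat).
Variables (X : forall i : 'I_N, set 'rV[R]_(d i)).
Variables (v : 'I_N -> 'rV[R]_(Dim d) -> R).
Variables (psi : forall i : 'I_N, 'rV[R]_(d i) -> R).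
Arguments X : clear implicits.
Arguments psi : clear implicits.
Hypothesis cX : forall i, convex_setv (X i).
Hypothesis dv : forall i x, profile_set X x -> differentiable (v i) x.
Implicit Types (w x y z s : 'rV[R]_(Dim d)).

(** The pseudo-gradient of the game at [x], which collects each player's gradient in its own block,
    paired with [w]. *)
Definition profile_grad x w : R :=
  \sum_(i < N) dotv (bgrad (v i) i x) (submxrow w i).

Definition minty x : Prop :=
  profile_set X x /\ forall z, profile_set X z -> profile_grad z (z - x) <= 0.

Definition profile_bregman x y : R :=
  \sum_(i < N) bregman (psi i) (submxrow x i) (submxrow y i).

Lemma profile_gradD x w z :
  profile_grad x (w + z) = profile_grad x w + profile_grad x z.
Proof.
rewrite -big_split; apply: eq_bigr => i _.
by rewrite submxrowD dotvDr.
Qed.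

Lemma profile_gradZ x (t : R) w :
  profile_grad x (t *: w) = t * profile_grad x w.
Proof.
rewrite mulr_sumr; apply: eq_bigr => i _.
by rewrite submxrowZ dotvZr.
Qed.

Lemma profile_gradN x w : profile_grad x (- w) = - profile_grad x w.
Proof. by rewrite -scaleN1r profile_gradZ mulN1r. Qed.

Lemma profile_grad_block x w i :
  (forall j, j != i -> submxrow w j = 0 :> 'rV_(d j)) ->
  profile_grad x w = dotv (bgrad (v i) i x) (submxrow w i).
Proof.
move=> w0; rewrite /profile_grad (bigD1 i) //= big1 ?addr0 // => j ji.
by rewrite w0 // dotv0r.
Qed.

Lemma cvg_profile_grad T (F : set_system T) {FF : Filter F} x
    (f : T -> 'rV[R]_(Dim d)) w :
  f t @[t --> F] --> w -> profile_grad x (f t) @[t --> F] --> profile_grad x w.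
Proof.
move=> fw; apply: cvg_sum => i _; apply: cvg_dotv; first exact: cvg_cst.
exact: cvg_submxrow.
Qed.

Lemma monotone_profile_grad x y : monotone_game X v ->
  profile_set X x -> profile_set X y ->
  profile_grad y (y - x) <= profile_grad x (y - x).
Proof.
move=> mono Xx Xy; rewrite -subr_le0 -sumrB.
apply: le_trans (mono y x Xy Xx); apply: ler_sum => i _.
by rewrite dotvDl dotvNl submxrowD submxrowN.
Qed.

(* Along the segment from [x] to a one-player deviation, the Minty inequality
   says exactly that the deviating player's payoff has nonpositive derivative,
   so no continuity of the gradient is needed. *)
Lemma minty_nash x : minty x -> nash_eq X v x.
Proof.
move=> [Xx mx]; split=> // i y dev Xy.
pose w := y - x.
have w0 j : j != i -> submxrow w j = 0 :> 'rV_(d j).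
  by move=> /dev ji; rewrite submxrowD submxrowN ji subrr.
have Xw : X i (submxrow (w + x) i) by rewrite subrK.
pose g (t : R) := v i (t *: w + x).
have Xt (t : R) : 0 <= t <= 1 -> profile_set X (t *: w + x).
  by move=> t01; have [] := deviation_line cX Xx w0 Xw t01.
(* Difference quotients of [g] are those of [v i] in direction [w], so [g] inherits derivability
   from [v i]. *)
have quotE (t : R) :
    (fun h : R => h^-1 *: ((g \o shift t) (h *: (1 : R)) - g t)) =
    (fun h : R =>
      h^-1 *: ((v i \o shift (t *: w + x)) (h *: w) - v i (t *: w + x))).
  apply/funext => h /=; rewrite /g; congr (_ *: (v i _ - _)).
  by rewrite scalerDl addrA; congr (_ *: _ + _ + _); exact: mulr1.
have dg (t : R) : 0 <= t <= 1 ->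
    is_derive t (1 : R) g ('D_w (v i) (t *: w + x)).
  move=> t01; have dvi := @diff_derivable _ _ _ _ _ w (dv i (Xt t t01)).
  by apply: DeriveDef; rewrite /derivable /derive quotE.
have [||c c01 gc] := @MVT R g (fun t => 'D_w (v i) (t *: w + x)) 0 1 ltr01.
- move=> t; rewrite in_itv /= => /andP[t0 t1].
  by apply: dg; rewrite !ltW.
- apply: derivable_within_continuous => t; rewrite in_itv /= => t01.
  by have [] := dg _ t01.
move: c01; rewrite in_itv /= => /andP[c0 c1].
have c01 : 0 <= c <= 1 by rewrite !ltW.
(* The Minty inequality is tested at the mean-value point, whose difference with [x] is [c *: w];
   since [c > 0], the factor [c] cancels. *)
have := mx _ (Xt _ c01); rewrite addrK profile_gradZ pmulr_rle0 //.
rewrite (profile_grad_block _ w0) -(derive_bgrad_block (dv i (Xt c c01)) w0).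
move=> Dle0; have : g 1 - g 0 <= 0 by rewrite gc subr0 mulr1.
by rewrite /g scale1r scale0r add0r subrK subr_le0.
Qed.

(** * First-order conditions and divergences of profiles *)

Hypothesis cpsi : forall i, C1_strongly_convex_near (psi i) (X i).
Variable mu : R.

(** Player [i] moves from [x] towards block [i] of [y], and optimality is differentiated at the
    start of the segment. The gradient of the divergence in its first argument is the difference of
    the gradients of [psi i]. *)
Lemma perturbed_eq_first_order s x y i :
  perturbed_eq X v psi mu s x -> profile_set X y ->
  dotv (bgrad (v i) i x) (submxrow (y - x) i) <=
  mu * dotv (gradr (psi i) (submxrow x i) - gradr (psi i) (submxrow s i))
            (submxrow y i - submxrow x i).
Proof.
move=> [Xx opt] Xy.
pose w := block_only i (y - x).
have w0 j : j != i -> submxrow w j = 0 :> 'rV_(d j).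
  exact: submxrow_block_only_neq.
have wi : submxrow w i = submxrow y i - submxrow x i :> 'rV_(d i).
  by rewrite submxrow_block_only submxrowD submxrowN.
have dpsi : differentiable (psi i) (submxrow x i).
  by have [U [_ [_ [XU [dU _]]]]] := cpsi i; apply/dU/XU/Xx.
rewrite submxrowD submxrowN -wi -(derive_bgrad_block (dv i Xx) w0).
rewrite dotvDl dotvNl.
rewrite -(derive_gradr _ dpsi).
apply: derive_le_derive.
- exact: diff_derivable (dv i Xx).
- exact: diff_derivable.
move=> t /andP[t0 t1].
have [] := @deviation_line _ _ _ X i x w t cX Xx w0.
- by rewrite submxrowD wi subrK; exact: Xy.
- by rewrite (ltW t0) t1.
move=> dev Xt; have := opt i _ dev (Xt i).
rewrite /bregman submxrowD submxrowZ !(dotvDr, dotvNr, dotvZr).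
set a := v i _; set b := v i _; set P := psi i _; set Q := psi i (submxrow x i).
by lra.
Qed.

Lemma perturbed_eq_step s x y :
  perturbed_eq X v psi mu s x -> profile_set X y ->
  profile_grad x (y - x) <=
  mu * (profile_bregman y s - profile_bregman y x - profile_bregman x s).
Proof.
move=> eqx Xy; rewrite /profile_bregman -!sumrB mulr_sumr.
apply: ler_sum => i _; rewrite -bregman_three_point.
exact: perturbed_eq_first_order.
Qed.

Lemma profile_bregman_ge0 x y :
  profile_set X x -> profile_set X y -> 0 <= profile_bregman x y.
Proof.
move=> Xx Xy; apply: sumr_ge0 => i _.
exact: bregman_ge0 (cpsi i) (Xx i) (Xy i).
Qed.

Lemma cvg_profile_bregman0 x T (F : set_system T) {FF : Filter F}
    (f : T -> 'rV[R]_(Dim d)) :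
  profile_set X x -> f t @[t --> F] --> x ->
  profile_bregman x (f t) @[t --> F] --> (0 : R).
Proof.
move=> Xx fx; apply: cvg_sum0 => i _; apply: (cvg_bregman0 (cpsi i) (Xx i)).
exact: cvg_submxrow.
Qed.

(** Strong convexity bounds the squared distance in block [i] by a multiple of that block's
    divergence, hence of the total. The constant depends on [i], so the squeeze is done block by
    block. *)
Lemma profile_bregman_cvg0 T (F : set_system T) {FF : Filter F}
    (a b : T -> 'rV[R]_(Dim d)) :
  (forall t, profile_set X (a t)) -> (forall t, profile_set X (b t)) ->
  profile_bregman (a t) (b t) @[t --> F] --> (0 : R) ->
  a t - b t @[t --> F] --> (0 : 'rV[R]_(Dim d)).
Proof.
move=> Xa Xb ab0; apply: (@cvg_sqnormv0 _ _ _ _ _ (fun t => a t - b t)).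
have -> : (fun t => sqnormv (a t - b t - 0)) =
    (fun t => \sum_(i < N) sqnormv (submxrow (a t) i - submxrow (b t) i)).
  apply/funext => t; rewrite subr0 /sqnormv /dotv sum_blocks.
  by apply: eq_bigr => i _; apply: eq_bigr => j _; rewrite !mxE.
apply: cvg_sum0 => i _; have [m m0 mP] := bregman_ge_sqnormv (cpsi i).
apply: (@squeeze_cvgr _ _ _ _ (fun=> 0)
  (fun t => m^-1 * profile_bregman (a t) (b t))).
- apply: nearW => t; rewrite sqnormv_ge0 /= ler_pdivlMl //.
  apply: le_trans (mP _ _ (Xa t i) (Xb t i)) _.
  rewrite /profile_bregman (bigD1 i) //= lerDl; apply: sumr_ge0 => j _.
  exact: bregman_ge0 (cpsi j) (Xa t j) (Xb t j).
- exact: cvg_cst.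
- by rewrite -[X in _ --> X](mulr0 m^-1); apply: cvgM => //; exact: cvg_cst.
Qed.

(** A single ultrafilter serves all blocks at once, so the block limits only have to be glued
    together. *)
Lemma profile_ultra_cvg T (U : set_system T) (f : T -> 'rV[R]_(Dim d)) :
  UltraFilter U -> (forall i, compact (X i)) ->
  (forall t, profile_set X (f t)) ->
  exists2 x, profile_set X x & f t @[t --> U] --> x.
Proof.
move=> UU kX Xf.
have lim_block i : exists2 p, X i p &
    (submxrow (f t) i : 'rV_(d i)) @[t --> U] --> p.
  by apply: compact_ultra_cvg => // t; exact: Xf.
have [p Xp fp] : exists2 p : forall i, 'rV[R]_(d i), forall i, X i (p i) &
    forall i, (submxrow (f t) i : 'rV_(d i)) @[t --> U] --> p i.
  exists (fun i => sval (cid2 (lim_block i))) => i.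
    by case: cid2.
  by case: cid2.
exists (\mxrow_i p i); first by move=> i; rewrite mxrowK.
apply: cvg_row => k; rewrite !mxE.
have -> : (fun t => f t 0 k) =
    (fun t => (submxrow (f t) (tagnat.sig1 k) : 'rV_(d _)) 0 (tagnat.sig2 k)).
  by apply/funext => t; rewrite !mxE tagnat.sig2K.
exact: cvg_coord.
Qed.

(** * The iterates and their limit points *)

Hypothesis kX : forall i, compact (X i).
Hypothesis mono : monotone_game X v.
Hypothesis mu_gt0 : 0 < mu.
Variable sigma : nat -> 'rV[R]_(Dim d).
Hypothesis X_sigma : forall k, profile_set X (sigma k).
Hypothesis eq_sigma : forall k, perturbed_eq X v psi mu (sigma k) (sigma k.+1).

(** The average starts at [sigma 1], since [sigma 0] comes with no first-order condition. *)
Let sigma_mean (K : nat) : 'rV[R]_(Dim d) :=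
  K.+1%:R^-1 *: \sum_(0 <= k < K.+1) sigma k.+1.

Lemma profile_set_mean K : profile_set X (sigma_mean K).
Proof.
elim: K => [|K IHK].
  by rewrite /sigma_mean big_nat1 invr1 scale1r; exact: X_sigma.
(* The weight of the previous mean in the new one, which is a convex combination of that mean and
   [sigma K.+2]. *)
pose t : R := K.+1%:R / K.+2%:R.
have KS0 : (K.+1%:R : R) != 0 by rewrite pnatr_eq0.
have KSS0 : (K.+2%:R : R) != 0 by rewrite pnatr_eq0.
have t01 : 0 <= t <= 1.
  by rewrite divr_ge0 //= ler_pdivrMr ?ltr0n // mul1r ler_nat.
have -> : sigma_mean K.+1 = t *: sigma_mean K + (1 - t) *: sigma K.+2.
  rewrite /sigma_mean big_nat_recr //= scalerDr scalerA.
  congr (_ *: _ + _ *: _).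
    by rewrite /t mulrAC divff // mul1r.
  by rewrite /t -[X in X - _](divff KSS0) -mulrBl -natrB // subSnn div1r.
move=> i; rewrite submxrowD (submxrowZ t) (submxrowZ (1 - t)).
exact: (cX (IHK i) (X_sigma K.+2 i) t01).
Qed.

(** Monotonicity moves the gradient from [sigma k.+1] to the fixed [y], where the terms add up
    linearly; the divergences then telescope, the nonnegative divergence between successive iterates
    being dropped. *)
Lemma profile_grad_sum y n : profile_set X y ->
  profile_grad y (n%:R *: y - \sum_(0 <= k < n) sigma k.+1) <=
  mu * (profile_bregman y (sigma 0%N) - profile_bregman y (sigma n)).
Proof.
move=> Xy; elim: n => [|n IHn].
  by rewrite scale0r big_geq // !subrr mulr0 -(scale0r 0) profile_gradZ mul0r.
rewrite big_nat_recr //= -natr1 scalerDl scale1r opprD addrACA profile_gradD.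
have step := perturbed_eq_step (eq_sigma n) Xy.
have := monotone_profile_grad mono (X_sigma n.+1) Xy.
have Dge0 : 0 <= mu * profile_bregman (sigma n.+1) (sigma n).
  by rewrite mulr_ge0 ?(ltW mu_gt0) // profile_bregman_ge0.
move: step IHn; rewrite !mulrBr; lra.
Qed.

Lemma minty_exists : exists x, minty x.
Proof.
have [U [UU leU]] := ultraFilterLemma eventually_filter.
have [x Xx meanx] := profile_ultra_cvg UU kX profile_set_mean.
exists x; split=> // y Xy.
pose B := mu * profile_bregman y (sigma 0%N).
(* Dividing the telescoped bound by [K.+1] leaves a constant times [harmonic K], the inverse of
   [K.+1]. *)
have le_mean K : profile_grad y (y - sigma_mean K) <= harmonic K * B.
  have -> : y - sigma_mean K =
      K.+1%:R^-1 *: (K.+1%:R *: y - \sum_(0 <= k < K.+1) sigma k.+1).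
    by rewrite scalerBr scalerA mulVf ?pnatr_eq0 // scale1r.
  rewrite profile_gradZ; apply: ler_wpM2l; first by rewrite invr_ge0.
  apply: le_trans (profile_grad_sum K.+1 Xy) _.
  by rewrite ler_pM2l // lerBlDr lerDl profile_bregman_ge0.
have harmonic0 : harmonic K @[K --> U] --> (0 : R).
  by move=> A /cvg_harmonic; exact: leU.
rewrite -(mul0r B).
apply: (@ler_cvg_to _ U _ _ (fun K => profile_grad y (y - sigma_mean K))
  (fun K => harmonic K * B)).
- by apply: cvg_profile_grad; apply: cvgB => //; exact: cvg_cst.
- by apply: cvgM => //; exact: cvg_cst.
- exact: nearW.
Qed.

(** In [perturbed_eq_step] with [y] equal to [p], the left side is nonnegative by the Minty
    inequality of [p] tested at [sigma k.+1]. *)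
Lemma minty_fejer p k : minty p ->
  profile_bregman p (sigma k.+1) + profile_bregman (sigma k.+1) (sigma k) <=
  profile_bregman p (sigma k).
Proof.
move=> [Xp mp].
have := le_trans _ (perturbed_eq_step (eq_sigma k) Xp).
move=> /(_ 0); rewrite pmulr_rge0 //.
rewrite -opprB profile_gradN oppr_ge0 => /(_ (mp _ (X_sigma k.+1))); lra.
Qed.

Lemma cvgn_minty_bregman p : minty p ->
  cvgn (fun k => profile_bregman p (sigma k)).
Proof.
move=> mp; have [Xp _] := mp; apply: nonincreasing_is_cvgn.
  apply/nonincreasing_seqP => k; apply: le_trans (minty_fejer k mp).
  by rewrite lerDl profile_bregman_ge0.
by exists 0 => _ [k _ <-]; exact: profile_bregman_ge0.
Qed.

Lemma cvg_sigma_step :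
  sigma k.+1 - sigma k @[k --> \oo] --> (0 : 'rV[R]_(Dim d)).
Proof.
have [p mp] := minty_exists; have [Xp _] := mp.
have cp := cvgn_minty_bregman mp.
apply: profile_bregman_cvg0 => [k|k|]; [exact: X_sigma | exact: X_sigma |].
apply: (@squeeze_cvgr _ _ _ _ (fun=> 0)
  (fun k => profile_bregman p (sigma k) - profile_bregman p (sigma k.+1))).
- apply: nearW => k; rewrite profile_bregman_ge0 //=.
  by have := minty_fejer k mp; lra.
- exact: cvg_cst.
(* A convergent sequence and its shift have the same limit, so the decrements vanish. *)
- rewrite -[X in _ --> X](subrr (limn (fun k => profile_bregman p (sigma k)))).
  apply: cvgB => //.
  by have := cvg_shiftS (fun k => profile_bregman p (sigma k)) => ->.
Qed.

Lemma minty_limit (U : set_system nat) x : ProperFilter U -> \oo `<=` U ->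
  profile_set X x -> sigma k @[k --> U] --> x -> minty x.
Proof.
move=> UU leU Xx sx; split=> // y Xy.
(* [U] need not be invariant under the shift, so the limit of [sigma k.+1] along [U] comes from the
   vanishing steps. *)
have sSx : sigma k.+1 @[k --> U] --> x.
  have -> : (fun k => sigma k.+1) = (fun k => sigma k.+1 - sigma k + sigma k).
    by apply/funext => k; rewrite subrK.
  rewrite -[x]add0r; apply: cvgD => //.
  by move=> A /cvg_sigma_step; exact: leU.
apply: (@ler_cvg_to _ U _ _ (fun k => profile_grad y (y - sigma k.+1))
  (fun k => mu * \sum_(i < N)
    dotv (gradr (psi i) (submxrow (sigma k.+1) i)
          - gradr (psi i) (submxrow (sigma k) i))
      (submxrow y i - submxrow (sigma k.+1) i))).
- by apply: cvg_profile_grad; apply: cvgB => //; exact: cvg_cst.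
- rewrite -[X in _ --> X](mulr0 mu); apply: cvgM; first exact: cvg_cst.
  apply: cvg_sum0 => i _.
  (* Both gradients of [psi i] tend to the one at [x], so their difference vanishes in the limit. *)
  have -> : 0 = dotv
      (gradr (psi i) (submxrow x i) - gradr (psi i) (submxrow x i))
      (submxrow y i - submxrow x i).
    by rewrite subrr /dotv big1 // => j _; rewrite mxE mul0r.
  apply: cvg_dotv; apply: cvgB.
  + by apply: (cvg_gradr (cpsi i) (Xx i)); exact: cvg_submxrow.
  + by apply: (cvg_gradr (cpsi i) (Xx i)); exact: cvg_submxrow.
  + exact: cvg_cst.
  + exact: cvg_submxrow.
- apply: nearW => k.
  apply: le_trans (monotone_profile_grad mono (X_sigma k.+1) Xy) _.
  rewrite mulr_sumr; apply: ler_sum => i _.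
  exact: perturbed_eq_first_order.
Qed.

Lemma cvg_sigma_minty : exists2 x, minty x & sigma k @[k --> \oo] --> x.
Proof.
have [U [UU leU]] := ultraFilterLemma eventually_filter.
have [x Xx sx] := profile_ultra_cvg UU kX X_sigma.
have mx : minty x by exact: minty_limit leU Xx sx.
exists x => //.
have cx := cvgn_minty_bregman mx.
have limU : profile_bregman x (sigma k) @[k --> U] -->
    limn (fun k => profile_bregman x (sigma k)).
  by move=> A /cx; exact: leU.
(* The divergence from [x] converges along the whole sequence, and its limit is identified as 0
   along [U]. *)
rewrite (cvg_unique _ limU (cvg_profile_bregman0 Xx sx)) // in cx.
have xs := @profile_bregman_cvg0 _ _ _ (fun=> x) sigma (fun=> Xx) X_sigma cx.
have xsx : x - (x - sigma k) @[k --> \oo] --> x - 0.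
  by apply: cvgB; [exact: cvg_cst | exact: xs].
have sigmaE : (fun k => x - (x - sigma k)) = sigma.
  by apply/funext => k; rewrite opprB addrC subrK.
by rewrite subr0 sigmaE in xsx.
Qed.

End Game.

Theorem theorem8 (R : realType) (N : nat) (d : 'I_N -> nat)
  (X : forall i : 'I_N, set 'rV[R]_(d i))
  (v : 'I_N -> 'rV[R]_(Dim d) -> R)
  (psi : forall i : 'I_N, 'rV[R]_(d i) -> R)
  (mu : R) (sigma : nat -> 'rV[R]_(Dim d)) :
  (0 < N)%N ->
  (forall i, X i !=set0) ->
  (forall i, compact (X i)) ->
  (forall i, convex_setv (X i)) ->
  (forall i x, profile_set X x -> differentiable (v i) x) ->
  monotone_game X v ->
  (forall i, C1_strongly_convex_near (psi i) (X i)) ->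
  0 < mu ->
  profile_set X (sigma 0%N) ->
  (forall k, perturbed_eq X v psi mu (sigma k) (sigma k.+1)) ->
  exists pistar, nash_eq X v pistar /\ sigma n @[n --> \oo] --> pistar.
Proof.
move=> _ _ kX cX dv mono cpsi mu0 X0 eqs.
have Xs k : profile_set X (sigma k) by case: k => // k; have [] := eqs k.
have [x mx sx] := cvg_sigma_minty cX dv cpsi kX mono mu0 Xs eqs.
by exists x; split=> //; exact: minty_nash.
Qed.
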